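(* Let $F\colon\mathcal{C}\to\mathcal{D}$ and $H\colon\mathcal{C}\to\mathcal{H}$ be functors. (a) If $(LF,\lambda)$ is a right Kan extension of $F$ along $H$, then $$\varphi_X\colon\operatorname{Nat}(X,LF)\to\operatorname{Nat}(X\circ H,F),\qquad\tau\mapsto\lambda\circ\tau_H$$ is a bijection, natural in $X\colon\mathcal{H}\to\mathcal{D}$. (b) Conversely, if there is a functor $LF\colon\mathcal{H}\to\mathcal{D}$ together with a natural family of bijections $\varphi_X\colon\operatorname{Nat}(X,LF)\to\operatorname{Nat}(X\circ H,F)$ indexed by all functors $X\colon\mathcal{H}\to\mathcal{D}$, then $(LF,\varphi_{LF}(\operatorname{id}_{LF}))$ is a right Kan extension of $F$ along $H$. Moreover, these two constructions are inverse to each other.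
   Context: $\operatorname{Nat}(A,B)$ is the collection of natural transformations $A\Rightarrow B$; $\tau_H$ denotes pre-whiskering with $H$ (size issues are ignored, e.g. by working with universes). A right Kan extension of $F$ along $H$ is a pair $(LF\colon\mathcal{H}\to\mathcal{D},\ \lambda\colon LF\circ H\Rightarrow F)$ such that for every $X\colon\mathcal{H}\to\mathcal{D}$ and every $\tau\colon X\circ H\Rightarrow F$ there is a unique $\bar\tau\colon X\Rightarrow LF$ with $\lambda\circ\bar\tau_H=\tau$. Naturality in $X$ means $\varphi_{X'}(\tau\circ\alpha)=\varphi_X(\tau)\circ\alpha_H$ for $\alpha\colon X'\Rightarrow X$. *)

(* Defs.v *)
From mathcomp Require Import ssreflect ssrfun.

Set Implicit Arguments.
Unset Strict Implicit.
Unset Printing Implicit Defensive.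

(* Objects and morphisms live in two independent universes, so large categories
   are covered.  Equality of morphisms is Leibniz equality. *)
Record category : Type := Category {
  ob :> Type;
  hom : ob -> ob -> Type;
  idm : forall a : ob, hom a a;
  compm : forall a b c : ob, hom b c -> hom a b -> hom a c;
  compmA : forall (a b c d : ob) (h : hom c d) (g : hom b c) (f : hom a b),
    compm h (compm g f) = compm (compm h g) f;
  comp1m : forall (a b : ob) (f : hom a b), compm (idm b) f = f;
  compm1 : forall (a b : ob) (f : hom a b), compm f (idm a) = f
}.
Arguments idm {c} a : rename.

Declare Scope cat_scope.
Delimit Scope cat_scope with cat.
Local Open Scope cat_scope.

Record functor (C D : category) : Type := Functor {
  fob :> C -> D;
  fmap : forall a b : C, hom a b -> hom (fob a) (fob b);
  fmap1 : forall a : C, fmap (idm a) = idm (fob a);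
  fmapM : forall (a b c : C) (g : hom b c) (f : hom a b),
    fmap (compm g f) = compm (fmap g) (fmap f)
}.
Arguments fmap {C D} F {a b} f : rename.

Lemma functor_comp1 (A B C : category) (G : functor B C) (F : functor A B)
  (a : A) : fmap G (fmap F (idm a)) = idm (G (F a)).
Proof. by rewrite !fmap1. Qed.

Lemma functor_compM (A B C : category) (G : functor B C) (F : functor A B)
  (a b c : A) (g : hom b c) (f : hom a b) :
  fmap G (fmap F (compm g f)) =
  compm (fmap G (fmap F g)) (fmap G (fmap F f)).
Proof. by rewrite !fmapM. Qed.

Definition functor_comp (A B C : category) (G : functor B C)
    (F : functor A B) : functor A C :=
  @Functor A C (fun a => G (F a)) (fun a b f => fmap G (fmap F f))
    (functor_comp1 G F) (functor_compM G F).

Notation "G \oF F" := (functor_comp G F)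
  (at level 50, left associativity) : cat_scope.

(* [Nat(F, G)].  Under functional extensionality and proof irrelevance, Leibniz
   equality in this type is equality of components. *)
Record nat_trans (C D : category) (F G : functor C D) : Type := NatTrans {
  nt_app :> forall a : C, hom (F a) (G a);
  nt_natural : forall (a b : C) (f : hom a b),
    compm (nt_app b) (fmap F f) = compm (fmap G f) (nt_app a)
}.

Lemma nt_id_natural (C D : category) (F : functor C D) (a b : C)
  (f : hom a b) : compm (idm (F b)) (fmap F f) = compm (fmap F f) (idm (F a)).
Proof. by rewrite comp1m compm1. Qed.

Definition nt_id (C D : category) (F : functor C D) : nat_trans F F :=
  @NatTrans C D F F (fun a => idm (F a)) (@nt_id_natural C D F).

Lemma nt_comp_natural (C D : category) (F G K : functor C D)
  (t : nat_trans G K) (s : nat_trans F G) (a b : C) (f : hom a b) :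
  compm (compm (t b) (s b)) (fmap F f) = compm (fmap K f) (compm (t a) (s a)).
Proof. by rewrite -compmA nt_natural compmA nt_natural compmA. Qed.

Definition nt_comp (C D : category) (F G K : functor C D)
    (t : nat_trans G K) (s : nat_trans F G) : nat_trans F K :=
  @NatTrans C D F K (fun a => compm (t a) (s a)) (nt_comp_natural t s).

Notation "t \oN s" := (nt_comp t s)
  (at level 50, left associativity) : cat_scope.

Lemma prewhisker_natural (A C D : category) (F G : functor C D)
  (t : nat_trans F G) (H : functor A C) (a b : A) (f : hom a b) :
  compm (t (H b)) (fmap F (fmap H f)) = compm (fmap G (fmap H f)) (t (H a)).
Proof. exact: nt_natural. Qed.

(* [t_H] *)
Definition prewhisker (A C D : category) (F G : functor C D)
    (t : nat_trans F G) (H : functor A C) : nat_trans (F \oF H) (G \oF H) :=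
  @NatTrans A D (F \oF H) (G \oF H) (fun a => t (H a))
    (prewhisker_natural t H).

(* A candidate right Kan extension [(LF, lambda)], without its universal
   property. *)
Record kan_pair (C D E : category) (F : functor C D) (H : functor C E) :=
  KanPair {
    kan_functor : functor E D;
    kan_counit : nat_trans (kan_functor \oF H) F
  }.

Definition is_right_kan_extension (C D E : category) (F : functor C D)
    (H : functor C E) (K : kan_pair F H) : Prop :=
  forall (X : functor E D) (t : nat_trans (X \oF H) F),
    exists! tbar : nat_trans X (kan_functor K),
      kan_counit K \oN prewhisker tbar H = t.

(* A functor [LF] with maps [phi_X : Nat(X, LF) -> Nat(X \oF H, F)] for all [X],
   with no naturality or bijectivity required. *)
Record nat_family (C D E : category) (F : functor C D) (H : functor C E) :=
  NatFamily {
    fam_functor : functor E D;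
    fam_map : forall X : functor E D,
      nat_trans X fam_functor -> nat_trans (X \oF H) F
  }.

Definition is_natural_family (C D E : category) (F : functor C D)
    (H : functor C E) (P : nat_family F H) : Prop :=
  forall (X X' : functor E D) (alpha : nat_trans X' X)
    (t : nat_trans X (fam_functor P)),
    fam_map (t \oN alpha) = fam_map t \oN prewhisker alpha H.

Definition is_natural_bijection (C D E : category) (F : functor C D)
    (H : functor C E) (P : nat_family F H) : Prop :=
  (forall X : functor E D, bijective (@fam_map C D E F H P X)) /\
  is_natural_family P.

Definition family_of_kan_pair (C D E : category) (F : functor C D)
    (H : functor C E) (K : kan_pair F H) : nat_family F H :=
  @NatFamily C D E F H (kan_functor K)
    (fun X t => kan_counit K \oN prewhisker t H).

Definition kan_pair_of_family (C D E : category) (F : functor C D)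
    (H : functor C E) (P : nat_family F H) : kan_pair F H :=
  @KanPair C D E F H (fam_functor P) (fam_map (nt_id (fam_functor P))).

(* Main.v *)
(** This is the Yoneda lemma for [X |-> Nat(X \oF H, F)]: naturality at
    [id \oN t] gives [phi_X t = phi_LF id \oN t_H], so a natural family is
    determined by [phi_LF id], and the unique factorization property of
    [(LF, lambda)] is exactly bijectivity of [t |-> lambda \oN t_H]. *)
Require Import Defs.
From mathcomp Require Import ssreflect ssrfun.
From Stdlib Require Import FunctionalExtensionality ProofIrrelevance.
From Stdlib Require Import IndefiniteDescription.

Set Implicit Arguments.
Unset Strict Implicit.
Unset Printing Implicit Defensive.
Local Open Scope cat_scope.

Lemma nat_trans_ext (C D : category) (F G : functor C D)
  (s t : nat_trans F G) : (forall a, s a = t a) -> s = t.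
Proof.
case: s t => [s sN] [t tN] /= eq_st.
have st := functional_extensionality_dep _ _ eq_st.
(* Eliminating [st] identifies the two component functions, which gives both naturality proofs the
   same type. *)
by case: _ / st tN {eq_st} => tN; congr NatTrans; apply: proof_irrelevance.
Qed.

Lemma nt_comp1l (C D : category) (F G : functor C D) (t : nat_trans F G) :
  nt_id G \oN t = t.
Proof. by apply: nat_trans_ext => a /=; rewrite comp1m. Qed.

Lemma nt_comp_prewhisker1 (C D E : category) (F : functor C D)
  (H : functor C E) (L : functor E D) (l : nat_trans (L \oF H) F) :
  l \oN prewhisker (nt_id L) H = l.
Proof. by apply: nat_trans_ext => a /=; rewrite compm1. Qed.

(** Functoriality of prewhiskering; this is the naturality in [X] required in part (a). *)
Lemma nt_comp_prewhiskerM (C D E : category) (F : functor C D)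
  (H : functor C E) (L X Y : functor E D) (l : nat_trans (L \oF H) F)
  (t : nat_trans X L) (s : nat_trans Y X) :
  l \oN prewhisker (t \oN s) H = l \oN prewhisker t H \oN prewhisker s H.
Proof. by apply: nat_trans_ext => a /=; rewrite compmA. Qed.

(** [bijective] asks for an inverse function, so description must turn the propositional [exists!]
    into a choice of preimages. *)
Lemma exists_unique_bijective (A B : Type) (f : A -> B) :
  (forall y, exists! x, f x = y) -> bijective f.
Proof.
move=> f_uniq.
pose g y := constructive_indefinite_description _ (f_uniq y).
exists (fun y => proj1_sig (g y)) => [x|y]; last by case: (proj2_sig (g y)).
(* Uniqueness makes the chosen preimage of [f x] equal to [x]. *)
by case: (proj2_sig (g (f x))) => _; apply.
Qed.

Lemma bijective_exists_unique (A B : Type) (f : A -> B) :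
  bijective f -> forall y, exists! x, f x = y.
Proof. by case=> g fK gK y; exists (g y); split=> // x <-. Qed.

Lemma fam_mapE (C D E : category) (F : functor C D) (H : functor C E)
  (P : nat_family F H) (X : functor E D) (t : nat_trans X (fam_functor P)) :
  is_natural_family P ->
  fam_map t = fam_map (nt_id (fam_functor P)) \oN prewhisker t H.
Proof. by move=> natP; rewrite -natP nt_comp1l. Qed.

Lemma kan_pair_of_familyK (C D E : category) (F : functor C D)
  (H : functor C E) (P : nat_family F H) :
  is_natural_family P -> family_of_kan_pair (kan_pair_of_family P) = P.
Proof.
case: P => L phi natP; congr NatFamily.
(* Both families have the same functor [L] by computation, so only the maps remain to be compared,
   with no transport. *)
apply: functional_extensionality_dep => X.
by apply: functional_extensionality => t; rewrite -(fam_mapE t natP).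
Qed.

Lemma family_of_kan_pairK (C D E : category) (F : functor C D)
  (H : functor C E) (K : kan_pair F H) :
  kan_pair_of_family (family_of_kan_pair K) = K.
Proof. by case: K => L l; congr KanPair; apply: nt_comp_prewhisker1. Qed.

Theorem proposition2p4 (C D E : category) (F : functor C D) (H : functor C E) :
  (forall K : kan_pair F H,
     is_right_kan_extension K -> is_natural_bijection (family_of_kan_pair K)) /\
  (forall P : nat_family F H,
     is_natural_bijection P -> is_right_kan_extension (kan_pair_of_family P)) /\
  (forall K : kan_pair F H,
     is_right_kan_extension K ->
     kan_pair_of_family (family_of_kan_pair K) = K) /\
  (forall P : nat_family F H,
     is_natural_bijection P ->
     family_of_kan_pair (kan_pair_of_family P) = P).
Proof.
split; [|split; [|split]] => [K kanK|P [bijP natP]|K _|P [_ natP]].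
- split=> [X|X X' alpha t]; last exact: nt_comp_prewhiskerM.
  exact: exists_unique_bijective (kanK X).
(* The universal property is unfolded as unique preimages under the map of the round-trip family;
   that family equals [P], whose maps are bijective. *)
- move=> X; apply: (@bijective_exists_unique _ _
    (@fam_map _ _ _ _ _ (family_of_kan_pair (kan_pair_of_family P)) X)).
  by rewrite kan_pair_of_familyK.
- exact: family_of_kan_pairK.
- exact: kan_pair_of_familyK.
Qed.
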